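(* Let $k\ge 3$ be an integer and let $\mathcal{B}_k$ be the class of $k$-partite $k$-uniform hypergraphs. For integers $d\ge 2$, $$\frac{\log_k d}{k-1}\;\le\; m_{\mathcal{B}_k}(d)\;\le\; k\,(1+o(1))\left(\frac{(k-1)d}{\ln d}\right)^{\frac{1}{k-1}},$$ where $o(1)$ denotes a quantity that tends to $0$ as $d\to\infty$ with $k$ fixed.
   Context: A hypergraph is a pair $(V,E)$ where $V$ is a set (of vertices) and $E$ is a family of subsets of $V$ (edges); it is $k$-uniform if every edge has exactly $k$ vertices. A $k$-uniform hypergraph is $k$-partite if its vertex set can be partitioned into $k$ disjoint subsets $V_1,\ldots,V_k$ such that every edge intersects each $V_i$ in exactly one vertex (different hypergraphs on the same vertex set may have different such partitions). The degree of a vertex is the number of edges containing it. A set $I\subseteq V$ is independent in $H=(V,E)$ if no edge of $H$ is contained in $I$. Given hypergraphs $H_1,\ldots,H_m$ (not necessarily distinct) with the same vertex set $V$, a cooperative coloring of them is a partition $\{I_1,\ldots,I_m\}$ of $V$ (indexed; parts may be empty) such that $I_i$ is independent in $H_i$ for each $i\in\{1,\ldots,m\}$. For a class $\mathcal{H}$ of hypergraphs, $m_{\mathcal{H}}(d)$ denotes the least number $m$ such that any $m$ hypergraphs (not necessarily distinct) from $\mathcal{H}$ on a common vertex set, each of maximum degree at most $d$, have a cooperative coloring. *)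

(* Defs.v *)
From mathcomp Require Import all_boot all_order all_algebra.
From mathcomp Require Import all_classical all_reals all_analysis.

Set Implicit Arguments.
Unset Strict Implicit.
Unset Printing Implicit Defensive.

Local Open Scope classical_set_scope.
Local Open Scope card_scope.

(* The vertex set is the whole type [V], which need not be finite. *)
Definition hypergraph (V : Type) := set (set V).

Definition uniform (k : nat) (V : Type) (H : hypergraph V) : Prop :=
  forall e, H e -> e #= `I_k.

(* Unlike [classical_sets.partition], parts may be empty. *)
Definition indexed_partition (n : nat) (V : Type) (P : 'I_n -> set V) : Prop :=
  cover setT P = setT /\ trivIset setT P.

Definition partite (k : nat) (V : Type) (H : hypergraph V) : Prop :=
  exists P : 'I_k -> set V, indexed_partition P /\
    forall e, H e -> forall i, e `&` P i #= `I_1.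

Definition max_degree_le (d : nat) (V : Type) (H : hypergraph V) : Prop :=
  forall v, [set e | H e /\ e v] #<= `I_d.

Definition independent (V : Type) (H : hypergraph V) (I : set V) : Prop :=
  forall e, H e -> ~ (e `<=` I).

Definition cooperative_coloring (m : nat) (V : Type)
    (H : 'I_m -> hypergraph V) (I : 'I_m -> set V) : Prop :=
  indexed_partition I /\ forall i, independent (H i) (I i).

Definition hypergraph_class := forall V : Type, hypergraph V -> Prop.

Definition partite_uniform (k : nat) : hypergraph_class :=
  fun V H => uniform k H /\ partite k H.

Definition always_colorable (C : hypergraph_class) (d m : nat) : Prop :=
  forall (V : Type) (H : 'I_m -> hypergraph V),
    (forall i, C V (H i) /\ max_degree_le d (H i)) ->
    exists I : 'I_m -> set V, cooperative_coloring H I.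

(* [m] is the number m_C(d). *)
Definition is_coop_number (C : hypergraph_class) (d m : nat) : Prop :=
  always_colorable C d m /\ forall n, always_colorable C d n -> (m <= n)%N.

(* Main.v *)
Require Import Defs.
From mathcomp Require Import all_boot all_order all_algebra.
From mathcomp Require Import all_classical all_reals all_analysis.
From mathcomp Require Import finmap ring lra.
Import Order.TTheory GRing.Theory Num.Theory.
Import numFieldNormedType.Exports.

(** Lower bound: on the vertex set [k]^n let the i-th hypergraph be the complete
k-partite one whose parts are the layers {v : v i = j}; its degrees are
k^((n-1)(k-1)). An independent set misses a layer of its hypergraph, so the
vertex whose i-th coordinate is the layer missed by I_i, for every i, gets no
colour.

Upper bound: with k t hypergraphs, every vertex v has a class j(v) such that v
lies in part j(v) of at least t of them; let L(v) be these t or more colours.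
Colour each v at random from L(v), then recolour each v with j(v) = k by a
colour i in L(v) for which no edge of H_i through v has all its other vertices
coloured i. A vertex w coloured i lies in part j(w) for H_i, so an edge with all
vertices coloured i would contain one with j = k, which excludes it; hence it
suffices that such an i exists for all v. By negative correlation over colours
and Harris' inequality within a colour, it fails to exist at v with probability
at most (1 - (1 - t^(1-k))^d)^t, which for t ~ ((k-1) d / ln d)^(1/(k-1)) is
smaller than any power of d, so the local lemma applies. Infinite vertex sets
follow by compactness. *)

Set Implicit Arguments.
Unset Strict Implicit.
Unset Printing Implicit Defensive.

Local Open Scope ring_scope.

(** * Averages over product spaces and the local lemma *)

Section ProductAverage.
Variables (R : realFieldType) (V A : finType) (L : V -> {set A}).
Hypothesis L_gt0 : forall w, (0 < #|L w|)%N.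
Implicit Types (c : V -> A) (f g : (V -> A) -> R) (s : seq V).

Definition upd c w a : V -> A := fun x => if x == w then a else c x.

Definition avg w f c : R := (\sum_(a in L w) f (upd c w a)) / #|L w|%:R.

(** With [s] the enumeration of [V] this is the expectation under independent uniform choices from
    the lists; coordinates off [s] keep their value in the argument. The iterated form permits
    arguments one coordinate at a time. *)
Fixpoint iter_avg s f : (V -> A) -> R :=
  if s is w :: s' then iter_avg s' (avg w f) else f.

Definition ignores (rT : Type) w (f : (V -> A) -> rT) :=
  forall c a, f (upd c w a) = f c.

Lemma avg_den_gt0 w : 0 < #|L w|%:R :> R.
Proof. by rewrite ltr0n. Qed.

Lemma upd_upd c w a b : upd (upd c w a) w b = upd c w b.
Proof. by apply/funext => x; rewrite /upd; case: eqP. Qed.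

Lemma updC c w u a b : w != u -> upd (upd c w a) u b = upd (upd c u b) w a.
Proof.
move=> wu; apply/funext => x; rewrite /upd.
by case: (x =P u) => [->|//]; rewrite eq_sym (negPf wu).
Qed.

Lemma avg_ignored w f g c :
  ignores w f -> avg w (fun c => f c * g c) c = f c * avg w g c.
Proof.
move=> fw; rewrite /avg (eq_bigr (fun a => f c * g (upd c w a))) => [|a _].
  by rewrite -mulr_sumr mulrA.
by rewrite fw.
Qed.

Lemma avg_const w (x : R) c : avg w (fun=> x) c = x.
Proof. by rewrite /avg sumr_const -[X in X / _]mulr_natr mulfK // gt_eqF ?avg_den_gt0. Qed.

Lemma avg_id w f : ignores w f -> avg w f = f.
Proof.
move=> fw; apply/funext => c; rewrite /avg (eq_bigr (fun=> f c)) => [|a _].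
  exact: (avg_const w).
exact: fw.
Qed.

Lemma ignores_avg u w f : ignores u f -> ignores u (avg w f).
Proof.
move=> fu c b; rewrite /avg; congr (_ / _); apply: eq_bigr => a _.
have [->|uw] := eqVneq u w; first by rewrite upd_upd.
by rewrite updC // fu.
Qed.

(** Independence: a factor ignoring [w] comes out of the average over [w], and averaging the other
    factor preserves the coordinates it ignores. *)
Lemma iter_avg_mul s f g c :
  (forall w, w \in s -> ignores w f \/ ignores w g) ->
  iter_avg s (fun c => f c * g c) c = iter_avg s f c * iter_avg s g c.
Proof.
elim: s f g => [//|w s IH] f g sfg /=.
have sfg' u : u \in s -> ignores u f \/ ignores u g.
  by move=> us; apply: sfg; rewrite inE us orbT.
have [fw|gw] := sfg w (mem_head _ _).
- rewrite -IH => [|u /sfg'[fu|gu]]; last by right; exact: ignores_avg.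
    congr (iter_avg s _ c); apply/funext => x.
    by rewrite avg_ignored // (avg_id fw).
  by left; exact: ignores_avg.
- rewrite -IH => [|u /sfg'[fu|gu]]; last by right; exact: ignores_avg.
    congr (iter_avg s _ c); apply/funext => x.
    rewrite [in RHS]mulrC (avg_id gw) // -avg_ignored //.
    by congr (avg w _ x); apply/funext => y; rewrite mulrC.
  by left; exact: ignores_avg.
Qed.

Lemma le_avg w f g : (forall c, f c <= g c) -> forall c, avg w f c <= avg w g c.
Proof.
by move=> fg c; rewrite /avg ler_pM2r ?invr_gt0 ?avg_den_gt0// ler_sum.
Qed.

Lemma le_iter_avg s f g : (forall c, f c <= g c) ->
  forall c, iter_avg s f c <= iter_avg s g c.
Proof. by elim: s f g => [//|w s IH] f g fg /=; apply/IH/le_avg. Qed.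

Lemma iter_avg_const s (x : R) c : iter_avg s (fun=> x) c = x.
Proof. by elim: s => [//|w s IH] /=; rewrite avg_id. Qed.

Lemma iter_avg_ge0 s f c : (forall c, 0 <= f c) -> 0 <= iter_avg s f c.
Proof.
by move=> f0; rewrite -(iter_avg_const s 0 c); exact: le_iter_avg.
Qed.

Lemma avgB w f g c : avg w (fun c => f c - g c) c = avg w f c - avg w g c.
Proof. by rewrite /avg sumrB mulrBl. Qed.

Lemma iter_avgB s f g c :
  iter_avg s (fun c => f c - g c) c = iter_avg s f c - iter_avg s g c.
Proof.
elim: s f g => [//|w s IH] f g /=; rewrite -IH.
by congr (iter_avg s _ c); apply/funext => x; rewrite avgB.
Qed.

(** A positive average has a positive term, found one coordinate at a time; coordinates off [s] are
    inherited from [c0]. *)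
Lemma iter_avg_witness s f c0 : (forall w, c0 w \in L w) ->
  0 < iter_avg s f c0 -> exists2 c, forall w, c w \in L w & 0 < f c.
Proof.
move=> c0L; elim: s f => [|w s IH] f /=; first by exists c0.
move=> /IH[c cL]; rewrite /avg pmulr_lgt0 ?invr_gt0 ?avg_den_gt0// => fc.
have [a aL fa] : exists2 a, a \in L w & 0 < f (upd c w a).
  apply/exists_inP; apply: contraLR fc => /exists_inPn nex; rewrite -leNgt.
  by apply: sumr_le0 => a /nex; rewrite -leNgt.
by exists (upd c w a) => // x; rewrite /upd; case: eqP => [->|].
Qed.

End ProductAverage.

Section LocalLemma.
Variables (R : realFieldType) (V A T : finType) (L : V -> {set A}).
Hypothesis L_gt0 : forall w, (0 < #|L w|)%N.
Variables (bad : T -> (V -> A) -> bool) (N : T -> {set V}) (D : nat).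
Hypothesis D_gt0 : (0 < D)%N.
Hypothesis bad_local : forall t w, w \notin N t -> ignores w (bad t).
Let near t u := ~~ [disjoint N t & N u].
Hypothesis near_le : forall t, (#|[set u | near t u]| <= D)%N.
Variable c0 : V -> A.
Hypothesis c0L : forall w, c0 w \in L w.
Let prob (b : (V -> A) -> bool) : R := iter_avg L (enum V) (fun c => (b c)%:R) c0.
Hypothesis bad_le : forall t, prob (bad t) * (4 * D%:R) <= 1.

Let good (s : seq T) c := all (fun u => ~~ bad u c) s.
Let x : R := (2 * D%:R)^-1.

Let D0 : 0 < D%:R :> R. Proof. by rewrite ltr0n. Qed.
Let D1 : 1 <= D%:R :> R. Proof. by rewrite ler1n. Qed.

Let x_ge0 : 0 <= x. Proof. by rewrite invr_ge0 mulr_ge0 ?ler0n. Qed.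

Let xD : x * D%:R = 2^-1.
Proof. by rewrite /x; field; rewrite gt_eqF. Qed.

Let x_le : x <= 2^-1.
Proof. by rewrite -xD ler_peMr. Qed.

Let prob_ge0 b : 0 <= prob b.
Proof. by apply: iter_avg_ge0. Qed.

Let bernoulli n : 1 - n%:R * x <= (1 - x) ^+ n.
Proof.
elim: n => [|n IH]; first by rewrite mul0r subr0 expr0.
rewrite exprS -natr1.
have x1 : 0 <= 1 - x by have := x_le; lra.
have := ler_wpM2l x1 IH; apply: le_trans.
have : 0 <= n%:R * x * x by rewrite !mulr_ge0.
nra.
Qed.

(** Division-free form of: [bad t] has probability at most [x] given [good s]. Events far from [t]
    are independent of [bad t]; restoring the at most [D] near ones keeps a fraction at least 1/2,
    so conditioning at most doubles the bound [1/(4D)]. *)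
Let good_cons_ge s t : uniq s ->
  (1 - x) * prob (good s) <= prob (good (t :: s)).
Proof.
have [n] := ubnP (size s); elim: n s t => [//|n IH] s t; rewrite ltnS => sn us.
pose s1 := [seq u <- s | near t u]; pose s2 := [seq u <- s | ~~ near t u].
have s12 c : good s c = good (s1 ++ s2) c.
  by apply: perm_all; rewrite perm_sym; apply/permPl/perm_filterC.
have Ps : prob (good s) = prob (good (s1 ++ s2)).
  by congr prob; apply/funext.
(* The near events are put back one by one, each by the induction hypothesis on a shorter list. *)
have cat_ge l : uniq (l ++ s2) -> (size (l ++ s2) <= n)%N ->
    (1 - x) ^+ size l * prob (good s2) <= prob (good (l ++ s2)).
  elim: l => [|u l IHl] /=; first by rewrite expr0 mul1r.
  move=> /andP[_ ul] sl; apply: le_trans (IH _ u sl ul).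
  rewrite exprS -mulrA ler_wpM2l //; first by have := x_le; lra.
  by apply: IHl => //; exact: ltnW.
have s1D : (size s1 <= D)%N.
  apply: leq_trans (near_le t); rewrite cardE uniq_leq_size ?filter_uniq// => u.
  by rewrite mem_filter mem_enum inE => /andP[].
have uE : perm_eq (s1 ++ s2) s by apply/permPl/perm_filterC.
have half : prob (good s2) <= 2 * prob (good s).
  have := cat_ge s1; rewrite (perm_uniq uE) (perm_size uE) => /(_ us sn).
  rewrite -Ps; have P2 := prob_ge0 (good s2).
  have hh : 2^-1 <= (1 - x) ^+ size s1.
    apply: le_trans (bernoulli _).
    have : (size s1)%:R * x <= 2^-1 by rewrite -xD mulrC ler_wpM2l ?ler_nat.
    lra.
  by have := ler_wpM2r P2 hh; lra.
have -> : prob (good (t :: s)) = prob (good s) - prob (fun c => bad t c && good s c).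
  rewrite /prob -iter_avgB; congr (iter_avg _ _ _ _); apply/funext => c /=.
  by case: (bad t c); rewrite /= ?subrr ?subr0.
have indep : prob (fun c => bad t c && good s2 c) = prob (bad t) * prob (good s2).
  rewrite /prob -iter_avg_mul //.
    congr (iter_avg _ _ _ _); apply/funext => c.
    by case: bad; rewrite ?mul1r ?mul0r.
  move=> w _; have [wt|wt] := boolP (w \in N t); last first.
    by left => c a; rewrite bad_local.
  right => c a; congr (nat_of_bool _)%:R; apply: eq_in_all => u.
  rewrite mem_filter negbK => /andP[tu _].
  by rewrite bad_local // (disjointFr tu).
have mono : prob (fun c => bad t c && good s c) <= prob (bad t) * prob (good s2).
  rewrite -indep; apply: le_iter_avg => // c; rewrite ler_nat s12 /good all_cat.
  by case: bad; case: (all _ s1); case: (all _ s2).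
have b0 := prob_ge0 (bad t); have g0 := prob_ge0 (good s).
have bx : prob (bad t) * 2 <= x.
  by rewrite /x -[leRHS]mul1r ler_pdivlMr ?mulr_gt0// (le_trans _ (bad_le t))//; lra.
have := ler_wpM2l b0 half; have := ler_wpM2r g0 bx.
lra.
Qed.

Theorem local_lemma :
  exists2 c, forall w, c w \in L w & forall t, ~~ bad t c.
Proof.
have Pgt0 s : uniq s -> 0 < prob (good s).
  elim: s => [|t s IH] /=; first by rewrite /prob iter_avg_const.
  move=> /andP[_ us]; apply: lt_le_trans (good_cons_ge t us).
  by rewrite mulr_gt0 ?IH//; have := x_le; lra.
have [c cL gc] := iter_avg_witness L_gt0 c0L (Pgt0 _ (enum_uniq T)).
exists c => // t; move: gc; rewrite ltr0n lt0b => /allP; apply.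
by rewrite mem_enum.
Qed.

End LocalLemma.

(** * Probability that every colour is blocked at a vertex *)

Section Potential.
Variables (R : realFieldType) (V A : finType) (L : V -> {set A}).
Hypothesis L_gt0 : forall w, (0 < #|L w|)%N.
Variables (S : {set A}) (F : A -> {set {set V}}).
Implicit Types (x : V -> A -> R) (c : V -> A) (s : seq V).

Definition potential x : R :=
  \prod_(i in S) (1 - \prod_(e in F i) (1 - \prod_(w in e) x w i)).

Definition weight w i : R := (i \in L w)%:R / #|L w|%:R.

(* The probability that [w] gets colour [i], once [c] is revealed off [s]. *)
Definition mixed s c w i : R := if w \in s then weight w i else (c w == i)%:R.

Let den_gt0 w : 0 < #|L w|%:R :> R. Proof. exact: avg_den_gt0. Qed.

Lemma weight_ge0 w i : 0 <= weight w i.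
Proof. by rewrite divr_ge0 ?ler0n. Qed.

Lemma weight_le1 w i : weight w i <= 1.
Proof.
rewrite ler_pdivrMr// mul1r ler_nat.
by case: (i \in L w) => //=; exact: L_gt0.
Qed.

Lemma sum_weight (h : A -> R) w :
  (\sum_(a in L w) h a) / #|L w|%:R = \sum_a weight w a * h a.
Proof.
rewrite mulr_suml big_mkcond; apply: eq_bigr => a _; rewrite /weight.
by case: (a \in L w); rewrite ?mul1r ?mul0r // mulrC.
Qed.

Lemma sum_weight1 w : \sum_a weight w a = 1.
Proof.
under eq_bigr do rewrite -[weight _ _]mulr1.
by rewrite -(sum_weight (fun=> 1)) sumr_const divff // gt_eqF.
Qed.

Lemma mixed_ge0 s c w i : 0 <= mixed s c w i.
Proof. by rewrite /mixed; case: ifP => _; rewrite ?weight_ge0 ?ler0n. Qed.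

Lemma mixed_le1 s c w i : mixed s c w i <= 1.
Proof. by rewrite /mixed; case: ifP => _; rewrite ?weight_le1// lern1 leq_b1. Qed.

Lemma onem_prod_mixed s c i (e : {set V}) :
  0 <= 1 - \prod_(w in e) mixed s c w i <= 1.
Proof.
rewrite subr_ge0 lerBlDr lerDl prodr_ge0 ?prodr_ile1 // => w _.
  by rewrite mixed_ge0 mixed_le1.
exact: mixed_ge0.
Qed.

(* The product is convex in [tau]: this is Harris' inequality for one coordinate. *)
Lemma prod_convex (I : Type) (l : seq I) (P Q : pred I) (y : I -> R) (tau : R) :
  0 <= tau <= 1 -> (forall e, 0 <= y e <= 1) ->
  let h t := \prod_(e <- l | P e) (1 - (if Q e then t else 1) * y e) in
  [/\ 0 <= h 1, h 1 <= h 0 & h tau <= (1 - tau) * h 0 + tau * h 1].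
Proof.
move=> /andP[t0 t1] y01 h; rewrite {}/h; elim: l => [|e l [h0 h10 ht]].
  by rewrite !big_nil; split => //; lra.
rewrite !big_cons; case: (P e); last by split.
have /andP[y0 y1] := y01 e; set y' := y e in y0 y1 *.
move: h0 h10 ht; set a := \prod_(_ <- _ | _) _; set b := \prod_(_ <- _ | _) _.
set z := \prod_(_ <- _ | _) _ => h0 h10 ht.
have ty : tau * y' <= 1 by rewrite mulr_ile1.
case: (Q e); rewrite ?(mul1r, mul0r, subr0); split => //; try by rewrite mulr_ge0 //; lra.
- have := mulr_ge0 y0 h0; nra.
- have t1' : 0 <= 1 - tau * y' by lra.
  have := ler_wpM2l t1' ht; set bt := 1 - tau => le1; apply: le_trans le1 _.
  have : 0 <= tau * (1 - tau) * y' * (b - a).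
    by rewrite !mulr_ge0 ?subr_ge0.
  rewrite /bt; nra.
- by rewrite ler_wpM2l ?subr_ge0.
- have y2 : 0 <= 1 - y' by lra.
  by have := ler_wpM2l y2 ht; nra.
Qed.

(* The indicators [a == i] are negatively correlated. *)
Lemma sum_prod_le (mu g0 g1 : A -> R) (l : seq A) : uniq l ->
  (forall a, 0 <= mu a) -> \sum_a mu a = 1 ->
  (forall a, 0 <= g0 a <= g1 a) ->
  \sum_a mu a * \prod_(i <- l) (if i == a then g1 i else g0 i)
    <= \prod_(i <- l) ((1 - mu i) * g0 i + mu i * g1 i).
Proof.
move=> ul mu0 mu1 g01; elim: l ul => [_|j l IH /= /andP[jl ul]].
  rewrite big_nil (eq_bigr mu) ?mu1 // => a _; by rewrite big_nil mulr1.
rewrite big_cons; have /andP[gj0 gj1] := g01 j.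
set X := \prod_(i <- l) _ in IH *; set Y := \sum_a _ in IH.
pose Z := \prod_(i <- l) g0 i.
have Z0 : 0 <= Z by apply: prodr_ge0 => i _; have /andP[] := g01 i.
have m1 a : mu a <= 1.
  by rewrite -mu1 (bigD1 a) //= lerDl sumr_ge0.
have ZX : Z <= X.
  apply: ler_prod => i _; have /andP[g0i g1i] := g01 i; rewrite g0i /=.
  by have := mu0 i; nra.
(* Only the term [a = j] sees [g1 j], and there all factors over [l] are [g0]; [Z <= X] and the
   induction hypothesis then finish. *)
have -> : \sum_a mu a * \prod_(i <- j :: l) (if i == a then g1 i else g0 i)
   = g0 j * Y + mu j * (g1 j - g0 j) * Z.
  rewrite mulr_sumr (bigD1 j) //= [in RHS](bigD1 j) //= big_cons eqxx.
  have Zj : \prod_(i <- l) (if i == j then g1 i else g0 i) = Z.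
    apply: eq_big_seq => i il; case: eqP => // ij.
    by move: jl; rewrite -ij il.
  rewrite Zj -[RHS]addrA [in RHS](addrC _ (mu j * _ * _)) addrA; congr (_ + _).
    by ring.
  apply: eq_bigr => a aj; rewrite big_cons eq_sym (negPf aj); ring.
have := ler_wpM2l gj0 (IH ul).
have mg : 0 <= mu j * (g1 j - g0 j) by rewrite mulr_ge0 ?subr_ge0.
have := ler_wpM2l mg ZX; lra.
Qed.

(* [potential] would be the probability of [blocked] if edges and colours were
   independent; revealing one more vertex does not increase it on average. *)
Lemma potential_avg_le s c w : w \notin s ->
  avg L w (fun c => potential (mixed s c)) c <= potential (mixed (w :: s) c).
Proof.
move=> ws.
(* [y i e] collects the vertices of [e] other than [w]; [g i t] is the factor of colour [i] when [w]
   gets [i] with probability [t]. Revealing [w] replaces [t = weight w i] by 0 or 1. *)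
pose y i (e : {set V}) := \prod_(u in e | u != w) mixed s c u i.
pose g i t := 1 - \prod_(e in F i) (1 - (if w \in e then t else 1) * y i e).
have y01 i e : 0 <= y i e <= 1.
  rewrite prodr_ge0 ?prodr_ile1 // => u _; rewrite ?mixed_ge0 ?mixed_le1//.
have splitE (x : V -> A -> R) i (e : {set V}) : (forall u, u != w -> x u i = mixed s c u i) ->
    \prod_(u in e) x u i = (if w \in e then x w i else 1) * y i e.
  move=> xE; have [we|we] := boolP (w \in e).
    by rewrite (bigD1 w) //=; congr (_ * _); apply: eq_bigr => u /andP[_ /xE].
  rewrite mul1r; apply: eq_big => [u|u ue].
    by case: (u =P w) => [->|]; rewrite ?(negPf we) // andbT.
  by apply: xE; apply: contraNneq we => <-.
have gP i : [/\ 0 <= g i 0, g i 0 <= g i 1 &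
    (1 - weight w i) * g i 0 + weight w i * g i 1 <= g i (weight w i)].
  have w01 : 0 <= weight w i <= 1 by rewrite weight_ge0 weight_le1.
  have [h0 h1 ht] := prod_convex (index_enum _) (mem (F i)) (fun e => w \in e) w01 (y01 i).
  rewrite /g; split; last by lra.
    rewrite subr_ge0 prodr_ile1 // => e _; have /andP[y0 y1] := y01 i e.
    by case: (w \in e); rewrite ?mul0r ?mul1r; lra.
  by lra.
rewrite /avg (sum_weight (fun a => potential (mixed s (upd c w a)))).
have -> : potential (mixed (w :: s) c) = \prod_(i in S) g i (weight w i).
  apply: eq_bigr => i _; congr (1 - _); apply: eq_bigr => e _; congr (1 - _).
  rewrite splitE => [|u uw]; last by rewrite /mixed inE (negPf uw).
  by rewrite /mixed mem_head.
have E a : potential (mixed s (upd c w a)) =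
   \prod_(i <- enum S) (if i == a then g i 1 else g i 0).
  rewrite big_enum /=; apply: eq_bigr => i _.
  have -> : (if i == a then g i 1 else g i 0) = g i (i == a)%:R by case: eqP.
  congr (1 - _); apply: eq_bigr => e _; congr (1 - _).
  rewrite splitE => [|u uw]; last by rewrite /mixed /upd (negPf uw).
  by rewrite /mixed (negPf ws) /upd eqxx eq_sym.
rewrite (eq_bigr (fun a => weight w a *
  \prod_(i <- enum S) (if i == a then g i 1 else g i 0))) => [|a _]; last by rewrite E.
have g01 a : 0 <= g a 0 <= g a 1 by have [? ? _] := gP a; apply/andP.
(* Negative correlation moves the average inside the product over colours; each factor is then
   bounded by the chord inequality in [gP]. *)
apply: le_trans (sum_prod_le (enum_uniq _) (weight_ge0 w) (sum_weight1 w) g01) _.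
rewrite big_enum /=; apply: ler_prod => i _; have [g0 g1 ->] := gP i.
have w0 := weight_ge0 w i; have w1 : 0 <= 1 - weight w i by rewrite subr_ge0 weight_le1.
by rewrite andbT; apply: addr_ge0; apply: mulr_ge0 => //; exact: le_trans g1.
Qed.

Lemma iter_avg_potential_le s s' c : uniq (s ++ s') ->
  iter_avg L s (fun c => potential (mixed s' c)) c
    <= potential (mixed (s ++ s') c).
Proof.
elim: s s' => [//|w s IH] s' /=.
rewrite mem_cat negb_or => /andP[/andP[ws ws'] uss'].
have h := le_iter_avg L_gt0 s (fun c => potential_avg_le c ws') c.
apply: le_trans h (le_trans (IH (w :: s') _) _).
  by rewrite uniq_catC /= mem_cat negb_or ws' ws uniq_catC.
rewrite le_eqVlt; apply/orP; left; apply/eqP; congr potential.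
apply/funext => u; apply/funext => i; rewrite /mixed !inE !mem_cat inE.
by rewrite orbCA.
Qed.

(** Used with [S] the list of a vertex and [F i] the edges of the [i]-th hypergraph through it, that
    vertex removed. *)
Definition blocked c :=
  [forall i in S, [exists e in F i, [forall w in e, c w == i]]].

Lemma potential_blocked c : (blocked c)%:R <= potential (mixed [::] c).
Proof.
have pot0 : 0 <= potential (mixed [::] c).
  apply: prodr_ge0 => i _; rewrite subr_ge0 prodr_ile1 // => e _.
  exact: onem_prod_mixed.
case blc: (blocked c) => //; move/forall_inP: blc => bl.
rewrite /potential big1 // => i /bl/exists_inP[e eF /forall_inP ce].
rewrite (bigD1 e) //= (_ : \prod_(w in e) _ = 1) ?subrr ?mul0r ?subr0 //.
by rewrite big1 // => w /ce cw; rewrite /mixed cw.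
Qed.

(** Before any vertex is revealed the potential is taken at the weights, each at most [1/t].
    Replacing weights by [1/t], [#|F i|] by [d] and [#|S|] by [t] only increases it. *)
Lemma blocked_le c (t d r : nat) : (0 < t)%N -> (t <= #|S|)%N ->
  (forall w, (t <= #|L w|)%N) ->
  (forall i, i \in S -> (#|F i| <= d)%N) ->
  (forall i e, i \in S -> e \in F i -> #|e| = r) ->
  iter_avg L (enum V) (fun c => (blocked c)%:R) c
    <= (1 - (1 - t%:R^-1 ^+ r) ^+ d) ^+ t :> R.
Proof.
move=> t_gt0 tS tL Fd Fr.
apply: le_trans (le_iter_avg L_gt0 _ potential_blocked _) _.
apply: le_trans (iter_avg_potential_le _ _) _; first by rewrite cats0 enum_uniq.
have t0 : 0 < t%:R :> R by rewrite ltr0n.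
have t01 : 0 <= (t%:R^-1 : R) ^+ r <= 1.
  rewrite exprn_ge0 ?invr_ge0 ?ler0n//= exprn_ile1 ?invr_ge0 ?ler0n//.
  by rewrite invf_le1 ?ler1n.
set q := 1 - t%:R^-1 ^+ r.
have q01 : 0 <= q <= 1 by rewrite /q; lra.
have /andP[q0 q1] := q01.
apply: (@le_trans _ _ (\prod_(i in S) (1 - q ^+ d))).
  apply: ler_prod => i iS; apply/andP; split.
    rewrite subr_ge0 prodr_ile1 // => e _.
    exact: onem_prod_mixed.
  rewrite lerD2l lerN2; apply: (@le_trans _ _ (\prod_(e in F i) q)).
    by rewrite prodr_const ler_wiXn2l// Fd.
  apply: ler_prod => e eF; rewrite q0 /q lerD2l lerN2 /= -(Fr i e iS eF) -prodr_const.
  apply: ler_prod => w _; rewrite mixed_ge0 /mixed cats0 mem_enum /=.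
  rewrite /weight; apply: (@le_trans _ _ (#|L w|%:R^-1)).
    by rewrite ler_piMl ?invr_ge0 ?ler0n// lern1 leq_b1.
  by rewrite lef_pV2 ?posrE// ler_nat.
rewrite prodr_const ler_wiXn2l // ?subr_ge0 ?exprn_ile1 // lerBlDr lerDl exprn_ge0//.
Qed.

End Potential.

(** * Colourings of finite hypergraphs *)

Lemma card_bigcup_le (I T : finType) (Q : pred I) (F : I -> {set T}) (b : nat) :
  (forall i, Q i -> (#|F i| <= b)%N) ->
  (#|\bigcup_(i | Q i) F i| <= #|[pred i | Q i]| * b)%N.
Proof.
move=> Fb.
have -> : (#|[pred i | Q i]| * b = \sum_(i | Q i) b)%N by rewrite -sum_nat_const.
apply: (big_rec2 (fun (A : {set T}) n => #|A| <= n)%N) => [|i n A Qi An].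
  by rewrite cards0.
by apply: leq_trans (leq_card_setU _ _) _; rewrite leq_add // Fb.
Qed.

Lemma popular_value (I : finType) (n t : nat) (q : I -> 'I_n) :
  (0 < t)%N -> (n * t <= #|I|)%N -> (0 < n)%N ->
  exists j, (t <= #|[set i | q i == j]|)%N.
Proof.
move=> t0 ntI n0; apply/existsP; apply: contraLR ntI => /existsPn small.
rewrite -ltnNge -sum1_card (partition_big q predT) //=.
apply: (@leq_ltn_trans (\sum_(j < n) t.-1)).
  apply: leq_sum => j _; rewrite sum1dep_card.
  by rewrite -ltnS prednK // ltnNge small.
by rewrite sum_nat_const card_ord ltn_pmul2l // prednK.
Qed.

Section FiniteColoring.
Variables (R : realFieldType) (V : finType) (r d t : nat).
Let m := (r.+1 * t)%N.
Variables (H : 'I_m -> {set {set V}}) (p : 'I_m -> V -> 'I_r.+1).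
Hypothesis edge_inj : forall i e, e \in H i -> {in e &, injective (p i)}.
Hypothesis edge_card : forall i e, e \in H i -> #|e| = r.+1.
Hypothesis deg_le : forall i v, (#|[set e in H i | v \in e]| <= d)%N.
Hypotheses (d_gt0 : (0 < d)%N) (t_gt0 : (0 < t)%N).
Hypothesis blocked_small :
  (1 - (1 - t%:R^-1 ^+ r) ^+ d) ^+ t * (4 * ((m * (d * r.+1)) ^ 2)%:R) <= 1 :> R.

Let nbhd v : {set V} := \bigcup_i \bigcup_(e in [set e in H i | v \in e]) e.

Let nbhdP v w :
  reflect (exists i e, [/\ e \in H i, v \in e & w \in e]) (w \in nbhd v).
Proof.
apply: (iffP bigcupP) => [[i _ /bigcupP[e]]|[i [e [eH ve we]]]].
  by rewrite inE => /andP[eH ve] we; exists i, e.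
by exists i => //; apply/bigcupP; exists e => //; rewrite inE eH.
Qed.

Let nbhd_sym v w : (w \in nbhd v) = (v \in nbhd w).
Proof. by apply/nbhdP/nbhdP => -[i [e [eH ve we]]]; exists i, e. Qed.

Let card_nbhd v : (#|nbhd v| <= m * (d * r.+1))%N.
Proof.
rewrite -[X in (_ <= X * _)%N]card_ord.
apply: (card_bigcup_le (Q := predT)) => i _.
apply: leq_trans (_ : #|[set e in H i | v \in e]| * r.+1 <= _)%N; last first.
  by rewrite leq_mul2r deg_le orbT.
rewrite -(eq_card (A := [pred e | e \in [set e in H i | v \in e]])) //.
by apply: card_bigcup_le => e; rewrite inE => /andP[/edge_card->].
Qed.

Theorem finite_coloring :
  exists c : V -> 'I_m, forall i e, e \in H i -> exists2 w, w \in e & c w != i.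
Proof.
have kt : (r.+1 * t <= #|'I_m|)%N by rewrite card_ord.
have /all_sig[j jP] v : {j | (t <= #|[set i | p i v == j]|)%N}.
  by apply: sigW; exact: popular_value.
pose L v := [set i | p i v == j v].
have L_gt0 v : (0 < #|L v|)%N by exact: leq_trans (jP v).
have /all_sig[c0 c0L] v : {i | i \in L v} by apply/sigW/card_gt0P.
pose star v i := [set e :\ v | e in [set e in H i | v \in e]].
pose bad v c := blocked (L v) (star v) c.
have bad_local v w : w \notin nbhd v -> ignores w (bad v).
  move=> wv c a; apply: eq_forallb_in => i _; apply: eq_existsb => f.
  case: (boolP (f \in star v i)) => //= /imsetP[e]; rewrite inE => /andP[eH ve] ->.
  apply: eq_forallb_in => u /setD1P[_ ue]; rewrite /upd; case: (u =P w) => // uw.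
  by case/negP: wv; apply/nbhdP; exists i, e; rewrite -uw.
(* Neighbourhoods meet only if [u] is a neighbour of a neighbour of [v], whence the square. *)
have near_le v : (#|[set u | ~~ [disjoint nbhd v & nbhd u]]| <= (m * (d * r.+1)) ^ 2)%N.
  apply: (@leq_trans #|\bigcup_(w in nbhd v) nbhd w|).
    apply/subset_leq_card/fintype.subsetP => u; rewrite inE.
    case/pred0Pn => w /andP[wv wu]; apply/bigcupP; exists w => //.
    by rewrite nbhd_sym.
  apply: leq_trans (card_bigcup_le (fun w _ => card_nbhd w)) _.
  by rewrite leq_mul2r card_nbhd orbT.
have D_gt0 : (0 < (m * (d * r.+1)) ^ 2)%N by rewrite expn_gt0 !muln_gt0 t_gt0 d_gt0.
have [v|c cL unblocked] := local_lemma (R := R) L_gt0 D_gt0 bad_local near_le c0L.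
  apply: le_trans blocked_small; rewrite ler_wpM2r ?mulr_ge0//.
  apply: blocked_le => //; [exact: jP|move=> i _|move=> i f _ /imsetP[e]].
    exact: leq_trans (leq_imset_card _ _) (deg_le _ _).
  rewrite inE => /andP[/edge_card eH ve] ->.
  by move: eH; rewrite (cardsD1 v) ve => -[].
have /all_sig[u uP] v : {i | i \in L v & ~~ [exists f in star v i, [forall w in f, c w == i]]}.
  by apply/sig2W/exists_inP; have := unblocked v; rewrite negb_forall_in.
(* [ord_max] stands for the last part: its vertices get an unblocked colour, all others keep the
   random one. *)
exists (fun v => if j v == ord_max then u v else c v) => i e eH.
apply/exists_inP; apply: contraT; rewrite negb_exists_in => /forall_inP mono.
have monoE w : w \in e -> (if j w == ord_max then u w else c w) = i.
  by move=> /mono; rewrite negbK => /eqP.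
(* Both [c w] and [u w] belong to [L w], so either colour puts [w] in part [j w]. *)
have pj w : w \in e -> p i w = j w.
  move=> /monoE; have := cL w; have [+ _] := uP w; rewrite !inE => /eqP h1 /eqP h2.
  by case: eqP => _ <-.
(* The [r.+1] vertices of [e] occupy distinct parts, hence all of them, including the last. *)
have : ord_max \in p i @: e.
  rewrite (_ : p i @: e = [set: 'I_r.+1]) ?inE //; apply/eqP.
  rewrite eqEcard finset.subsetT cardsT card_ord card_in_imset ?(edge_card eH)//.
    by rewrite ltnSn.
  exact: edge_inj eH.
case/imsetP => w0 w0e pw0; have jw0 : j w0 = ord_max by rewrite -pj.
have := monoE w0 w0e; rewrite jw0 eqxx => uw0.
(* By injectivity the other vertices of [e] are outside the last part and kept [c w = i], so
   [e :\ w0] blocks [i] at [w0], against the choice of [u w0]. *)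
have [_] := uP w0; rewrite uw0 => /exists_inP[]; exists (e :\ w0).
  by apply/imsetP; exists e => //; rewrite inE eH.
apply/forall_inP => w /setD1P[ww0 we]; have := monoE w we.
case: eqP => [jw _|_ ->//]; exfalso; move/eqP: ww0; apply.
by apply: (edge_inj eH) => //; rewrite pj // jw.
Qed.

End FiniteColoring.

(** * Compactness *)

Local Open Scope classical_set_scope.
Local Open Scope card_scope.

Lemma set_fin_card_eq (T : finType) (A : {set T}) : [set` A] #= `I_#|A|.
Proof.
rewrite (card_eqr card_II).
have -> : [set` A] = (@enum_val T (mem A)) @` [set: 'I_#|A|].
  apply/seteqP; split => [x xA|x [i _ <-]]; last exact: enum_valP.
  by exists (enum_rank_in xA x) => //; rewrite enum_rankK_in.
by apply: inj_card_eq => i j _ _; exact: enum_val_inj.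
Qed.

Lemma card_le1_inj (T : choiceType) (A : set T) x y :
  A #= `I_1 -> A x -> A y -> x = y.
Proof.
move=> A1; have fA : finite_set A by apply/finite_setP; exists 1.
have [X AX] := finite_fsetP.1 fA; move: A1; rewrite AX => /card_eq_fsetP/eqP/cardfs1P[z ->].
by rewrite /= !inE => /eqP-> /eqP.
Qed.

Section Compactness.
Variables (V : choiceType) (m : nat) (H : 'I_m -> hypergraph V).
Hypothesis edge_finite : forall i e, H i e -> finite_set e.
Hypothesis finite_col : forall s : seq V, exists c : V -> 'I_m,
  forall i e, H i e -> e `<=` [set` s] -> exists2 w, e w & c w != i.

(** The filter of properties that hold for all sufficiently large finite lists. *)
Let above : set_system (seq V) :=
  [set A | exists s0 : seq V, forall s : seq V, {subset s0 <= s} -> A s].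

Let above_filter : ProperFilter above.
Proof.
split; first by move=> [s0 /(_ s0)]; exact.
split; first by exists [::].
- move=> A B [s As] [s' Bs']; exists (s ++ s') => u uss; split.
  + by apply: As => x xs; apply: uss; rewrite mem_cat xs.
  + by apply: Bs' => x xs; apply: uss; rewrite mem_cat xs orbT.
- by move=> A B AB [s As]; exists s => u /As /AB.
Qed.

(** Give [v] the colour it has for almost all lists of an ultrafilter refining [above]. An edge is
    finite, so some list contains it and agrees with this colouring on all of it. *)
Lemma compact_coloring :
  exists c : V -> 'I_m, forall i e, H i e -> exists2 w, e w & c w != i.
Proof.
have [col colP] := choice finite_col.
have [G [Gu aboveG]] := ultraFilterLemma above_filter.
have GF := @ultra_proper _ _ Gu.
(* There are finitely many colours, so the ultrafilter selects one. *)
have colG v : exists i, G [set s | col s v = i].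
  apply: contrapT => /forallNP nG.
  have [X TX] := finite_fsetP.1 (@finite_finset _ [set: 'I_m]).
  have /filter_ex[s] : G (\bigcap_(i in [set` X]) ~` [set s | col s v = i]).
    apply: filter_bigI => i _.
    by have [/nG|] := in_ultra_setVsetC [set s | col s v = i] Gu.
  by rewrite -TX => /(_ (col s v) I); apply.
have [c cG] := choice colG.
exists c => i e eH; apply: contrapT => mono.
have ce w : e w -> c w = i.
  by move=> we; apply: contrapT => /eqP cw; apply: mono; exists w.
have [X eX] := finite_fsetP.1 (edge_finite eH).
have GX : G (\bigcap_(w in [set` X]) [set s | col s w = i]).
  by apply: filter_bigI => w wX; rewrite -(ce w) ?eX//; exact: cG.
have Gab : G [set s : seq V | {subset X <= s}].
  by apply: aboveG; exists (enum_fset X).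
have [s [/= sX Xs]] := @filter_ex _ _ GF _ (filterI GX Gab).
have [w ew] := colP s i e eH (ltac:(by rewrite eX => x /Xs)).
by rewrite (sX w) ?eqxx //; rewrite eX in ew.
Qed.

End Compactness.

(** * From finite to arbitrary vertex sets *)

Section Transfer.
Variables (R : realFieldType) (r d t : nat).
Hypotheses (d_gt0 : (0 < d)%N) (t_gt0 : (0 < t)%N).
Hypothesis blocked_small :
  (1 - (1 - t%:R^-1 ^+ r) ^+ d) ^+ t *
    (4 * ((r.+1 * t * (d * r.+1)) ^ 2)%:R) <= 1 :> R.

(** Only edges inside [s] matter, so they are pulled back to the finite type of elements of [s];
    cardinalities, parts and degrees survive because the inclusion is injective. *)
Lemma finite_restriction (V : choiceType)
    (H : 'I_(r.+1 * t) -> hypergraph V) (s : seq V) :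
  (forall i, partite_uniform r.+1 (H i) /\ max_degree_le d (H i)) ->
  exists c : V -> 'I_(r.+1 * t),
  forall i e, H i e -> e `<=` [set` s] -> exists2 w, e w & c w != i.
Proof.
move=> Hp; have m_gt0 : (0 < r.+1 * t)%N by rewrite muln_gt0.
have [Q QP] := choice (fun i => (Hp i).1.2).
have Qcover i v : exists j, Q i j v.
  have [[Qc _] _] := QP i; have : cover setT (Q i) v by rewrite Qc.
  by case=> j _ Qv; exists j.
have /choice[q qP] : forall iv : 'I_(r.+1 * t) * V, exists j, Q iv.1 j iv.2.
  by move=> iv; exact: Qcover.
pose T : finType := seq_sub s; pose sv : T -> V := @ssval V s.
have sv_inj : injective sv by exact: val_inj.
pose lift_edge (e : {set T}) : set V := sv @` [set` e].
pose K i : {set {set T}} := [set e | `[< H i (lift_edge e) >]]%SET.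
pose p i (x : T) := q (i, sv x).
have lift_inj : injective lift_edge.
  move=> e f ef; apply/setP => x.
  have sub (a b : {set T}) : lift_edge a = lift_edge b -> x \in a -> x \in b.
    move=> ab xa; have : lift_edge b (sv x) by rewrite -ab; exists x.
    by case=> y yb /sv_inj <-.
  by apply/idP/idP; apply: sub.
have KI i e : e \in K i -> H i (lift_edge e) by rewrite inE => /asboolP.
have K_inj i e : e \in K i -> {in e &, injective (p i)}.
  move=> /KI eH x y xe ye pxy.
  have [_ /(_ _ eH (p i x))] := QP i.
  move=> e1; have zx : (lift_edge e `&` Q i (p i x)) (sv x).
    by split; [exists x|exact: (qP (i, sv x))].
  have zy : (lift_edge e `&` Q i (p i x)) (sv y).
    by rewrite pxy; split; [exists y|exact: (qP (i, sv y))].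
  by apply: sv_inj; exact: card_le1_inj e1 zx zy.
have K_card i e : e \in K i -> #|e| = r.+1.
  move=> /KI eH; have [[+ _] _] := Hp i.
  move=> /(_ _ eH); rewrite (card_eql (inj_card_eq _)) => [|x y _ _]; last exact: sv_inj.
  by rewrite (card_eql (set_fin_card_eq e)) => /card_eq_II.
have K_deg i v : (#|[set e in K i | v \in e]%SET| <= d)%N.
  rewrite -card_le_II -(card_le_eql (set_fin_card_eq _)).
  have inj : {in [set` [set e in K i | v \in e]%SET] &, injective lift_edge}.
    by move=> x y _ _; exact: lift_inj.
  rewrite -(card_le_eql (inj_card_eq inj)).
  apply: card_le_trans ((Hp i).2 (sv v)); apply: subset_card_le => f [e /=].
  by rewrite inE => /andP[/KI eH ve] <-; split => //; exists v.
have [c cP] := finite_coloring K_inj K_card K_deg d_gt0 t_gt0 blocked_small.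
(* Vertices off [s] get an arbitrary colour, which no edge inside [s] sees. *)
exists (fun v => if insub v is Some x then c x else Ordinal m_gt0) => i e eH es.
have eE : lift_edge [set x | sv x \in e]%SET = e.
  apply/seteqP; split => [_ [x + <-]|v ev] /=; first by rewrite /= inE => /set_mem.
  by exists (SeqSub (es v ev)) => //=; rewrite inE; apply/mem_set.
have eK : [set x | sv x \in e]%SET \in K i by rewrite inE eE; apply/asboolP.
have [x + cx] := cP i _ eK; rewrite inE => /set_mem ex.
by exists (sv x) => //; rewrite (valK x).
Qed.

Theorem partite_always_colorable :
  always_colorable (partite_uniform r.+1) d (r.+1 * t).
Proof.
(* [{classic V0}] provides the choice structure that finite lists of vertices require. *)
move=> V0 H Hp; pose V : choiceType := {classic V0}.
have [c cP] : exists c : V -> 'I_(r.+1 * t),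
    forall i e, H i e -> exists2 w, e w & c w != i.
  apply: (@compact_coloring V) => [i e eH|s]; last exact: finite_restriction.
  by apply/finite_setP; exists r.+1; exact: (Hp i).1.1.
exists (fun i => [set v | c v = i]); split; first split.
- by apply/seteqP; split => // v _; exists (c v).
- by move=> i j _ _ [v [<- <-]].
- move=> i e eH sub; have [w ew] := cP i e eH.
  by rewrite (sub w ew) eqxx.
Qed.

End Transfer.

(** * The lower bound *)

Section CompletePartite.
Variables (r n : nat).
Let V := {ffun 'I_n.+1 -> 'I_r.+1}.

(** [f] picks one vertex per layer of coordinate [i]; allowing every such [f] gives the complete
    partite hypergraph. *)
Definition layer_hypergraph (i : 'I_n.+1) : hypergraph V :=
  [set e | exists2 f : 'I_r.+1 -> V, (forall j, f j i = j) & e = range f].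

Lemma layer_partite_uniform i : partite_uniform r.+1 (layer_hypergraph i).
Proof.
split=> [_ [f fi ->]|].
  have -> : (range f #= `I_r.+1) = ([set: 'I_r.+1] #= `I_r.+1).
    by apply/card_eql/inj_card_eq => x y _ _ fxy; rewrite -(fi x) fxy fi.
  by rewrite card_eq_sym; exact: card_II.
exists (fun j => [set v : V | v i = j]); split; first split.
- by apply/seteqP; split => // v _; exists (v i).
- by move=> j j' _ _ [v [<- <-]].
- move=> _ [f fi ->] j.
  rewrite (_ : _ `&` _ = [set f j]); first exact: card_set1.
  apply/seteqP; split => [_ [[j' _ <-] /=]|_ ->]; first by rewrite fi => ->.
  by split => //=; exists j.
Qed.

(** An edge through [v] is determined by its vertices in the [r] other layers, each with [n] free
    coordinates; [point] rebuilds the edge from these data. *)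
Lemma layer_max_degree i :
  max_degree_le ((r.+1 ^ n) ^ r) (layer_hypergraph i).
Proof.
move=> v; pose T := {ffun 'I_r -> {ffun 'I_n -> 'I_r.+1}}.
pose point (g : T) (j : 'I_r.+1) : V :=
  if unlift (v i) j is Some j' then
    [ffun l => if unlift i l is Some l' then g j' l' else j] else v.
have T_card : [set: T] #= `I_((r.+1 ^ n) ^ r).
  have -> : ((r.+1 ^ n) ^ r = #|T|)%N by rewrite !card_ffun !card_ord.
  rewrite (card_eqr card_II) (_ : [set: T] = enum_val @` [set: 'I_#|T|]).
    by apply: inj_card_eq => x y _ _; exact: enum_val_inj.
  by apply/seteqP; split => // x _; exists (enum_rank x) => //; rewrite enum_rankK.
rewrite -(card_le_eqr T_card).
apply: card_le_trans (card_image_le (fun g => range (point g)) [set: T]).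
apply: subset_card_le => _ [[f fi ->] [j0 _ fj0]].
have fv : f (v i) = v by rewrite -fj0 fi.
exists [ffun j => [ffun l => f (lift (v i) j) (lift i l)]] => //.
suff -> : point [ffun j => [ffun l => f (lift (v i) j) (lift i l)]] = f by [].
apply/funext => j; rewrite /point.
case: unliftP => [j' ->|->]; last by rewrite fv.
apply/ffunP => l; rewrite !ffunE; case: unliftP => [l' ->|->].
  by rewrite !ffunE.
by rewrite fi.
Qed.

Lemma layer_not_colorable d : ((r.+1 ^ n) ^ r <= d)%N ->
  ~ always_colorable (partite_uniform r.+1) d n.+1.
Proof.
move=> nd /(_ V layer_hypergraph)[i|I [[Icover _] Iindep]].
  split=> [|v]; first exact: layer_partite_uniform.
  by apply: card_le_trans (layer_max_degree i v) _; rewrite card_le_II.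
have missed i : exists j, forall v, I i v -> v i <> j.
  apply: contrapT => /forallNP hit.
  have /choice[f fP] j : exists v, I i v /\ v i = j.
    by apply: contrapT => /forallNP h; apply: (hit j) => v Iv vj; apply: (h v).
  apply: (Iindep i (range f)); first by exists f => // j; have [] := fP j.
  by move=> _ [j _ <-]; have [] := fP j.
have [x xP] := choice missed.
have : cover setT I [ffun i => x i] by rewrite Icover.
by case=> i _ /xP; rewrite ffunE.
Qed.

End CompletePartite.

Lemma not_colorable0 k d : ~ always_colorable (partite_uniform k) d 0.
Proof.
move=> /(_ unit (fun=> set0))[[]//|I [[Icover _] _]].
by have : cover setT I tt; [rewrite Icover|case=> -[]].
Qed.

(** * Asymptotics *)

Local Close Scope card_scope.
Local Open Scope ring_scope.

Section Numerics.
Variable R : realType.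
Implicit Types (x y eps : R).

(** Raise [1 + u <= expR u] at [u = y / n] to the power [n]. *)
Lemma expR_ge_exp y n : 0 <= y -> (0 < n)%N -> (y / n%:R) ^+ n <= expR y.
Proof.
move=> y0 n0; have n0' : 0 < n%:R :> R by rewrite ltr0n.
have yn : 0 <= y / n%:R by rewrite divr_ge0 // ltW.
have -> : expR y = expR (y / n%:R) ^+ n.
  by rewrite -expRM_natl mulrC divfK // gt_eqF.
rewrite lerXn2r ?nnegrE ?expR_ge0 //.
by apply: le_trans (expR_ge1Dx _); rewrite lerDr.
Qed.

Lemma expR_le_onemV x : 1 < x -> expR (- (x - 1)^-1) <= 1 - x^-1.
Proof.
move=> x1; have x10 : 0 < x - 1 by rewrite subr_gt0.
have -> : 1 - x^-1 = (1 + (x - 1)^-1)^-1.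
  have x0 : x != 0 by rewrite gt_eqF // (lt_trans _ x1).
  field.
  by rewrite subrK x0 gt_eqF.
by rewrite expRN lef_pV2 ?posrE ?expR_gt0 ?expR_ge1Dx // addr_gt0 ?invr_gt0.
Qed.

(** The root in the upper bound, with [r = k - 1]. *)
Definition rate (r d : nat) : R := ((r%:R * d%:R) / ln d%:R) `^ (1 / r%:R).

Lemma rateX r d : (0 < r)%N -> 0 < ln (d%:R : R) ->
  rate r d ^+ r = r%:R * d%:R / ln d%:R.
Proof.
move=> r0 L0; have r0' : r%:R != 0 :> R by rewrite pnatr_eq0 -lt0n.
rewrite /rate -powR_mulrn ?powR_ge0 // -powRrM div1r mulVf // powRr1 //.
by rewrite divr_ge0 ?mulr_ge0 // ltW.
Qed.

(** Comparing [r]-th powers, the claim is [d / L ^ r <= r d / L] for [L = ln d >= 1]. *)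
Lemma rate_ge r d : (0 < r)%N -> 1 <= ln (d%:R : R) ->
  expR (ln d%:R / r%:R) / ln d%:R <= rate r d.
Proof.
move=> r0 L1; set L := ln _ in L1 *; have L0 : 0 < L by exact: lt_le_trans L1.
have d0 : (0 : R) < d%:R.
  by rewrite ltNge; apply/negP => /ln0 d0; move: L0; rewrite /L d0 ltxx.
rewrite -(ler_pXn2r r0) ?nnegrE ?powR_ge0 ?divr_ge0 ?expR_ge0 ?(ltW L0)//.
have expd : expR (L / r%:R) ^+ r = d%:R.
  by rewrite -expRM_natl mulrC divfK ?pnatr_eq0 -?lt0n // lnK.
rewrite rateX // expr_div_n expd mulrAC.
have Lr : L <= L ^+ r by rewrite ler_eXnr.
have i1 : (L ^+ r)^-1 <= L^-1 by rewrite lef_pV2 ?posrE ?exprn_gt0.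
have r1 : 1 <= r%:R :> R by rewrite ler1n.
rewrite -/L mulrC ler_wpM2r ?(ltW d0) //.
by apply: le_trans i1 _; rewrite ler_peMl ?invr_ge0 ?(ltW L0).
Qed.

Lemma rate_ge_ln r d : (0 < r)%N -> 1 <= ln (d%:R : R) ->
  ln d%:R / (4 * r%:R ^+ 2) <= rate r d.
Proof.
move=> r0 L1; apply: le_trans (rate_ge r0 L1).
set L := ln _ in L1 *; have L0 : 0 < L by exact: lt_le_trans L1.
have r0' : 0 < r%:R :> R by rewrite ltr0n.
rewrite ler_pdivlMr //.
have := @expR_ge_exp (L / r%:R) 2 (divr_ge0 (ltW L0) (ltW r0')) isT.
apply: le_trans; rewrite le_eqVlt; apply/orP; left; apply/eqP; field.
by rewrite gt_eqF.
Qed.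

(** Take [t] as the integer part of [(1 + eps) X], with [X] the rate and [L = ln d]. A colour is
    unblocked with probability at least [z], and [t z >= kap L^2], so the failure bound
    [exp(- kap L^2)] beats the dependency count, at most [exp(C + 4 L)]. *)
Lemma good_list_size r eps : (0 < r)%N -> 0 < eps ->
  exists L0 : R, forall d : nat, L0 <= ln d%:R -> exists t : nat,
  [/\ (0 < d)%N, (0 < t)%N, t%:R <= (1 + eps) * rate r d &
   (1 - (1 - t%:R^-1 ^+ r) ^+ d) ^+ t *
     (4 * ((r.+1 * t * (d * r.+1)) ^ 2)%:R) <= 1 :> R].
Proof.
move=> r0 e0; have r0' : 0 < r%:R :> R by rewrite ltr0n.
(* This is [1/r - 1/(r (1 + eps/4))], the exponent of [d] left in [X z]. *)
pose eta : R := (eps / 4) / (r%:R * (1 + eps / 4)).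
have e4 : 0 < eps / 4 by rewrite divr_gt0.
have e41 : 0 < 1 + eps / 4 by rewrite addr_gt0.
have eta0 : 0 < eta by rewrite divr_gt0 ?mulr_gt0.
pose kap : R := (eta / 3) ^+ 3.
have kap0 : 0 < kap by rewrite exprn_gt0 // divr_gt0.
pose C : R := 4 * r.+1%:R ^+ 4.
have C0 : 0 <= C by rewrite mulr_ge0 ?exprn_ge0.
(* [L >= B1] forces [X >= 1 + 4/eps], absorbing rounding losses; [B2] gives [t <= d]; [B3] gives the
   final comparison [C + 4 <= kap L]. *)
pose B1 : R := (4 * r%:R ^+ 2) * (1 + 4 / eps).
pose B2 : R := (1 + eps) ^+ r * r%:R.
pose B3 : R := (C + 4) / kap.
have B10 : 0 <= B1 by rewrite !mulr_ge0 ?addr_ge0 ?exprn_ge0 ?divr_ge0 ?ltW.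
have B20 : 0 <= B2 by rewrite mulr_ge0 ?exprn_ge0 ?addr_ge0 ?ltW.
have B30 : 0 <= B3 by rewrite divr_ge0 ?addr_ge0 // ltW.
exists (1 + B1 + B2 + B3) => d; set L := ln _ => LB.
have L1 : 1 <= L by lra.
have LB1 : B1 <= L by lra.
have LB2 : B2 <= L by lra.
have LB3 : B3 <= L by lra.
have L0 : 0 < L by exact: lt_le_trans L1.
have d0 : (0 : R) < d%:R.
  by rewrite ltNge; apply/negP => /ln0 d0; move: L0; rewrite /L d0 ltxx.
have dE : d%:R = expR L by rewrite lnK.
have d1 : 1 <= d%:R :> R by rewrite ler1n -(ltr0n R).
set X := rate r d.
have XL : 1 + 4 / eps <= X.
  apply: le_trans (rate_ge_ln r0 L1); rewrite ler_pdivlMr ?mulr_gt0 ?exprn_gt0 //.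
  by rewrite mulrC.
have fe : 0 < 4 / eps by rewrite divr_gt0.
have X1 : 1 <= X by lra.
have X0 : 0 < X by exact: lt_le_trans X1.
have eX : 4 <= eps * X.
  have : 4 / eps <= X by lra.
  by rewrite ler_pdivrMr // mulrC.
have XrE : X ^+ r = r%:R * d%:R / L by rewrite rateX.
have XXr : X <= X ^+ r by rewrite ler_eXnr.
have eXX : 0 <= (1 + eps) * X by rewrite mulr_ge0 ?addr_ge0 // ltW.
pose t := Num.truncn ((1 + eps) * X).
have /andP[tle tgt] := truncn_itv eXX.
rewrite -/t in tle tgt.
have tge : (1 + eps / 2) * X <= t%:R by move: tgt; rewrite -natr1; lra.
have tX : X <= t%:R.
  by apply: le_trans tge; rewrite ler_peMl ?(ltW X0) // lerDl divr_ge0 // ltW.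
have t0 : (0 < t)%N by rewrite -(ltr0n R); exact: lt_le_trans tX.
have t0' : 0 < t%:R :> R by rewrite ltr0n.
have e21 : 1 <= 1 + eps / 2 by rewrite lerDl divr_ge0 // ltW.
pose T : R := t%:R ^+ r.
have TX : (1 + eps / 4) * X ^+ r <= T - 1.
  have h : (1 + eps / 2) * X ^+ r <= T.
    apply: (@le_trans _ _ (((1 + eps / 2) * X) ^+ r)).
      by rewrite exprMn ler_wpM2r ?exprn_ge0 ?(ltW X0) // ler_eXnr.
    by rewrite lerXn2r ?nnegrE ?mulr_ge0 ?(ltW X0) ?(le_trans ler01 e21).
  have : eps * X <= eps * X ^+ r by rewrite ler_pM2l.
  lra.
have Xr0 : 0 < X ^+ r by rewrite exprn_gt0.
have T10 : 0 < T - 1 by apply: lt_le_trans TX; rewrite mulr_gt0.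
have T1 : 1 < T by rewrite -subr_gt0.
have T0 : 0 < T by exact: lt_trans T1.
have Ti1 : T^-1 <= 1 by rewrite invf_le1 // ltW.
pose z : R := expR (- (L / (r%:R * (1 + eps / 4)))).
have zle : z <= (1 - t%:R^-1 ^+ r) ^+ d.
  rewrite exprVn -/T; apply: (@le_trans _ _ (expR (- (T - 1)^-1) ^+ d)).
    rewrite -expRM_natl ler_expR mulrN lerN2 ler_pdivrMr //.
    have h : 0 <= L / (r%:R * (1 + eps / 4)) by rewrite divr_ge0 ?mulr_ge0 ?ltW.
    apply: le_trans (ler_wpM2l h TX); rewrite XrE le_eqVlt; apply/orP; left.
    by apply/eqP; field; rewrite !gt_eqF //; lra.
  by rewrite lerXn2r ?nnegrE ?expR_ge0 ?subr_ge0 ?expR_le_onemV.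
have T01 : 0 <= (t%:R^-1 : R) ^+ r <= 1.
  by rewrite exprVn -/T invr_ge0 Ti1 ltW.
have base0 : 0 <= 1 - (1 - t%:R^-1 ^+ r) ^+ d :> R.
  by have /andP[? ?] := T01; rewrite subr_ge0 exprn_ile1 ?subr_ge0 // lerBlDr lerDl.
(* [X z] is at least [exp(eta L) / L], and the cubic bound on the exponential leaves [kap L^2]. *)
have tz : kap * L ^+ 2 <= t%:R * z.
  apply: (@le_trans _ _ (expR (eta * L) / L)).
    rewrite ler_pdivlMr //.
    have h := @expR_ge_exp (eta * L) 3 (mulr_ge0 (ltW eta0) (ltW L0)) isT.
    apply: le_trans h; rewrite /kap; lra.
  apply: (@le_trans _ _ (X * z)); last by rewrite ler_wpM2r ?expR_ge0.
  apply: (@le_trans _ _ (expR (L / r%:R) / L * z)); last first.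
    by rewrite ler_wpM2r ?expR_ge0 // rate_ge.
  rewrite [leRHS]mulrAC /z -expRD ler_wpM2r ?invr_ge0 ?(ltW L0) // ler_expR.
  rewrite le_eqVlt; apply/orP; left; apply/eqP; rewrite /eta; field.
  by rewrite !gt_eqF //; lra.
have pow : (1 - (1 - t%:R^-1 ^+ r) ^+ d) ^+ t <= expR (- (kap * L ^+ 2)).
  apply: (@le_trans _ _ (expR (- z) ^+ t)).
    rewrite lerXn2r ?nnegrE ?expR_ge0 //.
    by apply: le_trans (expR_ge1Dx _); rewrite lerD2l lerN2.
  by rewrite -expRM_natl ler_expR mulrN lerN2.
have td : t%:R <= d%:R :> R.
  apply: le_trans tle _.
  rewrite -(ler_pXn2r r0) ?nnegrE //.
  apply: (@le_trans _ _ d%:R); last by rewrite ler_eXnr.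
  rewrite exprMn XrE mulrA ler_pdivrMr // [leRHS]mulrC mulrA.
  by rewrite ler_wpM2r // ltW.
have size : 4 * ((r.+1 * t * (d * r.+1)) ^ 2)%:R <= expR (C + 4 * L).
  have -> : 4 * ((r.+1 * t * (d * r.+1)) ^ 2)%:R = C * (t%:R ^+ 2 * d%:R ^+ 2).
    by rewrite natrX !natrM /C; ring.
  rewrite expRD; apply: ler_pM; rewrite ?mulr_ge0 ?exprn_ge0 //.
    by apply: le_trans (expR_ge1Dx _); rewrite lerDr.
  rewrite expRM_natl -dE (exprD _ 2 2) ler_wpM2r ?exprn_ge0 //.
  by rewrite lerXn2r ?nnegrE.
exists t; split => //; first by rewrite -(ltr0n R).
apply: le_trans (ler_pM _ _ pow size) _; rewrite ?exprn_ge0 ?mulr_ge0 //.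
rewrite -expRD -[leRHS]expR0 ler_expR.
have h : C + 4 <= kap * L by move: LB3; rewrite ler_pdivrMr // mulrC.
have h2 : (C + 4) * L <= kap * L * L by rewrite ler_pM2r.
rewrite addrC subr_le0 expr2 mulrA; apply: le_trans h2.
by rewrite [leRHS]mulrDl lerD2r ler_peMr.
Qed.

End Numerics.

(** * Bounds on the cooperative number *)

Lemma always_colorable_le k d d' m : (d <= d')%N ->
  always_colorable (partite_uniform k) d' m ->
  always_colorable (partite_uniform k) d m.
Proof.
move=> dd' col V H Hp; apply: col => i; have [puH degH] := Hp i.
by split=> // v; apply: card_le_trans (degH v) _; rewrite card_le_II.
Qed.

Lemma ln_nat_ge (R : realType) (x : R) :
  exists N, forall d, (N <= d)%N -> x <= ln d%:R.
Proof.
exists (Num.truncn (expR x)).+1 => d Nd; rewrite -[x]expRK.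
have xd : expR x <= d%:R.
  by apply: le_trans (ltW (truncnS_gt _)) _; rewrite ler_nat.
by rewrite ler_ln ?posrE ?expR_gt0 // (lt_le_trans _ xd) ?expR_gt0.
Qed.

Lemma eventually_colorable (R : realType) r (eps : R) : (0 < r)%N -> 0 < eps ->
  exists N, forall d, (N <= d)%N -> exists2 m,
    always_colorable (partite_uniform r.+1) d m &
    m%:R <= r.+1%:R * (1 + eps) * rate R r d.
Proof.
move=> r0 /(good_list_size r0)[L0 hL]; have [N hN] := ln_nat_ge L0.
exists N => d /hN/hL[t [d0 t0 tle small]]; exists (r.+1 * t)%N.
  exact: partite_always_colorable small.
by rewrite natrM -mulrA ler_pM2l.
Qed.

(** For [m = n + 1] the layer hypergraphs force [d < k^(n r)], so [log_k d / r] is at most [n]. *)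
Lemma coop_number_ge (R : realType) r d m : (0 < r)%N -> (2 <= d)%N ->
  always_colorable (partite_uniform r.+1) d m ->
  (ln d%:R / ln r.+1%:R) / r%:R <= m%:R :> R.
Proof.
move=> r0 d2; case: m => [/not_colorable0//|n col].
have dlt : (d < (r.+1 ^ n) ^ r)%N.
  by rewrite ltnNge; apply/negP => /layer_not_colorable.
have lnk : 0 < ln (r.+1%:R : R) by rewrite ln_gt0 // ltr1n.
have r0' : 0 < r%:R :> R by rewrite ltr0n.
rewrite !ler_pdivrMr //; apply: (@le_trans _ _ (ln ((r.+1 ^ n) ^ r)%:R)).
  by rewrite ler_ln ?posrE ?ltr0n ?expn_gt0 ?ler_nat ?(ltnW dlt) // (ltn_trans _ d2).
rewrite -expnM natrX lnXn ?ltr0n // -[leLHS]mulr_natl -natrM ler_wpM2r ?(ltW lnk) //.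
by rewrite ler_nat leq_mul2r leqnSn orbT.
Qed.

Theorem theorem3p2 (R : realType) (k : nat) (hk : (3 <= k)%N) :
  exists m : nat -> nat,
    (forall d : nat, (2 <= d)%N -> is_coop_number (partite_uniform k) d (m d)) /\
    exists o : nat -> R,
      o @ \oo --> 0 /\
      forall d : nat, (2 <= d)%N ->
        (ln d%:R / ln k%:R) / (k%:R - 1) <= (m d)%:R :> R /\
        (m d)%:R <= k%:R * (1 + o d) *
          (((k%:R - 1) * d%:R) / ln d%:R) `^ (1 / (k%:R - 1)).
Proof.
case: k hk => [//|r] hr; have r0 : (0 < r)%N by exact: ltnW.
have -> : r.+1%:R - 1 = r%:R :> R by rewrite -natr1 addrK.
pose colorable d n := `[< always_colorable (partite_uniform r.+1) d n >].
(* A colourable number for a large degree bound also serves every smaller one. *)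
have ex d : exists n, colorable d n.
  have [N hN] := @eventually_colorable R r 1 r0 ltr01.
  have [n col _] := hN (maxn N d) (leq_maxl _ _).
  by exists n; apply/asboolP/(always_colorable_le (leq_maxr N d)).
pose m d := ex_minn (ex d).
have mP d : is_coop_number (partite_uniform r.+1) d (m d).
  rewrite /m; case: ex_minnP => n /asboolP col min_n; split=> // n' coln'.
  by apply: min_n; apply/asboolP.
exists m; split=> [d _|]; first exact: mP.
pose ratio d : R := (m d)%:R / (r.+1%:R * rate R r d).
have rate0 d : (2 <= d)%N -> 0 < r.+1%:R * rate R r d.
  move=> d2; rewrite mulr_gt0 // powR_gt0 // divr_gt0 ?mulr_gt0 ?ltr0n //.
    exact: ltnW.
  by rewrite ln_gt0 // ltr1n.
(* The error is the excess of the ratio over 1, cut off at 0: the upper bound then holds for all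
   [d >= 2], and only the limit needs the asymptotic estimate. *)
exists (fun d => Num.max 0 (ratio d - 1)); split; last first.
  move=> d d2; split; first exact: coop_number_ge r0 d2 (mP d).1.
  rewrite mulrAC -ler_pdivrMl ?rate0 // mulrC -/(ratio d).
  by rewrite -lerBlDl le_max lexx orbT.
apply/cvgr0Pnorm_le => eps eps0.
have [N hN] := eventually_colorable r0 eps0.
exists (maxn N 2) => // d; rewrite /= geq_max => /andP[Nd d2].
have [n col nle] := hN d Nd.
rewrite ger0_norm ?le_max ?lexx // ge_max (ltW eps0) /= lerBlDl.
rewrite ler_pdivrMr ?rate0 // mulrCA mulrA.
by apply: le_trans nle; rewrite ler_nat (mP d).2.
Qed.
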